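(* Let $\sigma$ and $w$ be two Radon measures on $\mathbb{R}$. If $[\sigma,w]_{A_2}^{**}<\infty$, then $[\sigma,w]_{A_2}^*<\infty$ and $[w,\sigma]_{A_2}^*<\infty$. More precisely, with an absolute implied constant, $$[\sigma,w]_{A_2}^*+[w,\sigma]_{A_2}^*\lesssim[\sigma,w]_{A_2}^{**}.$$
   Context: For an interval $I$, $c_I$ is its centre and $|I|$ its length. For a measure $\nu$ and a function $f$, the Poisson integral is $$P(f\,d\nu,I):=\int_{\mathbb{R}}\frac{|I|f(x)\,d\nu(x)}{|I|^2+(x-c_I)^2}.$$ For each finite interval $I$, let $b_I$ be the unique (if it exists) point such that $$P(1_{\{b_I\}}d\sigma,I)>\tfrac12P(d\sigma,I)\quad\text{and}\quad P(1_{\{b_I\}}dw,I)>\tfrac12P(dw,I).$$ Let $\tilde\sigma_I:=\sigma-\sigma\{b_I\}\delta_{b_I}$ if $b_I$ exists and $\tilde\sigma_I:=\sigma$ otherwise; define $\tilde w_I$ similarly from $w$. Then $$([\sigma,w]_{A_2}^{**})^2:=\sup_I\Big(P(d\tilde\sigma_I,I)P(dw,I)+P(d\tilde w_I,I)P(d\sigma,I)\Big),$$ the supremum being over finite intervals $I$. $[\sigma,w]_{A_2}^*$ and $[w,\sigma]_{A_2}^*$ are the best constants in $[0,\infty]$ such that for all finite intervals $I\subset\mathbb{R}$ $$\sigma(I)\int_{I^c}\frac{dw(x)}{(x-c_I)^2}\le([\sigma,w]_{A_2}^* )^2,\qquad w(I)\int_{I^c}\frac{d\sigma(x)}{(x-c_I)^2}\le([w,\sigma]_{A_2}^*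 )^2.$$ *)

(* Defs.v *)
From HB Require Import structures.
From mathcomp Require Import all_boot all_order all_algebra.
From mathcomp Require Import all_classical all_reals all_analysis.
From mathcomp Require Import measurable_realfun.
From mathcomp Require Import lra.

Set Implicit Arguments.
Unset Strict Implicit.
Unset Printing Implicit Defensive.

Import Order.TTheory GRing.Theory Num.Theory.
Import numFieldNormedType.Exports.

Local Open Scope classical_set_scope.
Local Open Scope ring_scope.
Local Open Scope ereal_scope.

(* On the real line a Borel measure that is finite on compact sets is
   automatically inner and outer regular. *)
Definition radon (R : realType)
    (mu : {measure set (measurableTypeR R) -> \bar R}) : Prop :=
  forall K : set R, compact K -> mu K < +oo.

(* Bounded, with any choice of open or closed endpoints, and non-degenerate. *)
Definition finite_itv (R : realType) (I : interval R) : bool :=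
  match I with
  | Interval (BSide _ a) (BSide _ b) => (a < b)%R
  | _ => false
  end.

(* Only meaningful on bounded intervals; the centre is [miditv]. *)
Definition itv_length (R : realType) (I : interval R) : R :=
  match I with
  | Interval (BSide _ a) (BSide _ b) => (b - a)%R
  | _ => 0%R
  end.

Definition poisson (R : realType) (nu : set (measurableTypeR R) -> \bar R)
    (f : R -> R) (I : interval R) : \bar R :=
  \int[nu]_x
    (itv_length I * f x / (itv_length I ^+ 2 + (x - miditv I) ^+ 2))%:E.

Definition dominant_atom (R : realType)
    (sigma w : set (measurableTypeR R) -> \bar R) (I : interval R)
    (b : R) : Prop :=
  poisson sigma \1_[set b] I > (2^-1)%:E * poisson sigma (cst 1%R) I /\
  poisson w \1_[set b] I > (2^-1)%:E * poisson w (cst 1%R) I.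

(* The point b_I, or [None] if there is none; see [dominant_atom_unique]. *)
Definition atom_pt (R : realType)
    (sigma w : set (measurableTypeR R) -> \bar R) (I : interval R) : option R :=
  match pselect (exists b, dominant_atom sigma w I b) with
  | left h => Some (projT1 (cid h))
  | right _ => None
  end.

(* For a Radon measure this is again a measure, see [remove_atomE]. *)
Definition remove_atom (R : realType)
    (mu : set (measurableTypeR R) -> \bar R) (b : R) :
    set (measurableTypeR R) -> \bar R :=
  fun A => mu A - mu [set b] * \d_b A.

(* [tilde sigma w I sigma] and [tilde sigma w I w] are the two modified
   measures attached to the pair (sigma, w) and the interval I. *)
Definition tilde (R : realType)
    (sigma w : set (measurableTypeR R) -> \bar R) (I : interval R)
    (mu : set (measurableTypeR R) -> \bar R) :
    set (measurableTypeR R) -> \bar R :=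
  if atom_pt sigma w I is Some b then remove_atom mu b else mu.

Definition A2_double_star (R : realType)
    (sigma w : set (measurableTypeR R) -> \bar R) : \bar R :=
  sqrte (ereal_sup
    [set poisson (tilde sigma w I sigma) (cst 1%R) I * poisson w (cst 1%R) I
       + poisson (tilde sigma w I w) (cst 1%R) I * poisson sigma (cst 1%R) I
    | I in [set I : interval R | finite_itv I]]).

Definition A2_star (R : realType)
    (sigma w : set (measurableTypeR R) -> \bar R) : \bar R :=
  ereal_inf [set C : \bar R | 0 <= C /\
    forall I : interval R, finite_itv I ->
      sigma [set` I] * \int[w]_(x in ~` [set` I]) ((x - miditv I) ^- 2)%:E
        <= C ^+ 2].

Section basic_facts.
Variable R : realType.
Implicit Types (mu sigma w : {measure set (measurableTypeR R) -> \bar R}).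

Lemma radon_set1 mu (b : R) : radon mu -> mu [set b] < +oo.
Proof. by apply; exact: compact_set1. Qed.

Lemma remove_atomE mu (b : R) (A : set (measurableTypeR R)) :
  radon mu -> measurable A -> remove_atom mu b A = mu (A `\ b).
Proof.
move=> rmu mA; rewrite /remove_atom diracE.
have mb : measurable ([set b] : set (measurableTypeR R)) by exact: measurable_set1.
have fb : mu [set b] \is a fin_num by rewrite ge0_fin_numE// radon_set1.
case: (boolP (b \in A)) => [|] /=; last first.
  rewrite notin_setE => bA; rewrite mule0 sube0; congr (mu _).
  by apply/seteqP; split => [x Ax|x []//]; split => // xb; apply: bA; rewrite -xb.
rewrite inE => bA; rewrite mule1.
have -> : mu A = mu [set b] + mu (A `\ b).
  rewrite -measureU//; last 2 first.
  - exact: measurableD.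
  - by apply/seteqP; split => x // [-> []] _; apply.
  by congr (mu _); rewrite setDUK// => x ->.
by rewrite addeAC subee// add0e.
Qed.

Lemma measurable_poisson (f : R -> R) (I : interval R) : finite_itv I ->
  measurable_fun setT (f : measurableTypeR R -> R) ->
  measurable_fun setT (EFin \o (fun x : measurableTypeR R =>
    itv_length I * f x / (itv_length I ^+ 2 + (x - miditv I) ^+ 2))%R).
Proof.
case: I => [[bl l|//] [br r|//]] /= lr mf; apply/measurable_EFinP.
apply: measurable_funM; first exact: measurable_funM.
have d0 (x : R) : (0 < (r - l) ^+ 2 + (x - (l + r) / 2) ^+ 2)%R.
  by rewrite ltr_wpDr ?sqr_ge0// exprn_gt0// subr_gt0.
apply: continuous_measurable_fun => x.
apply: cvgV; first by rewrite gt_eqF.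
apply: cvgD; first exact: cvg_cst.
by apply: cvgM; apply: cvgB; [exact: cvg_id|exact: cvg_cst|exact: cvg_id|exact: cvg_cst].
Qed.

Lemma dominant_atom_unique sigma w (I : interval R) (b b' : R) :
  finite_itv I ->
  dominant_atom sigma w I b -> dominant_atom sigma w I b' -> b = b'.
Proof.
move=> fI [hb _] [hb' _]; apply/eqP; apply/negPn/negP => /eqP bb'.
have L0 : (0 < itv_length I)%R.
  by case: I fI {hb hb'} => [[bl l|//] [br r|//]] /=; rewrite subr_gt0.
have d0 (x : R) : (0 < itv_length I ^+ 2 + (x - miditv I) ^+ 2)%R.
  by rewrite ltr_wpDr ?sqr_ge0// exprn_gt0.
have ge0 (f : R -> R) (x : R) : (0 <= f x)%R ->
    0 <= (itv_length I * f x / (itv_length I ^+ 2 + (x - miditv I) ^+ 2))%:E.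
  by move=> f0; rewrite lee_fin divr_ge0 ?mulr_ge0// ltW.
have m1 (c : R) : measurable_fun setT (\1_[set c] : measurableTypeR R -> R).
  exact: measurable_indic.
have le : poisson sigma \1_[set b] I + poisson sigma \1_[set b'] I
          <= poisson sigma (cst 1%R) I.
  rewrite /poisson -ge0_integralD//=; last 4 first.
  - by move=> x _; exact: ge0.
  - exact: measurable_poisson.
  - by move=> x _; exact: ge0.
  - exact: measurable_poisson.
  apply: ge0_le_integral => //=.
  - by move=> x _; rewrite adde_ge0//; exact: ge0.
  - by apply: emeasurable_funD; exact: measurable_poisson.
  - by apply: measurable_poisson => //; exact: measurable_cst.
  move=> x _; rewrite -EFinD lee_fin -mulrDl -mulrDr.
  rewrite ler_wpM2r ?invr_ge0 ?(ltW (d0 _))// ler_wpM2l ?(ltW L0)//.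
  rewrite !indicE; have [xb|_] := boolP (x \in [set b]); last first.
    by rewrite add0r; case: (_ \in _).
  have [xb'|_] := boolP (x \in [set b']); last by rewrite addr0.
  by move: xb xb'; rewrite !inE => -> /bb'.
have P0 : 0 <= poisson sigma (cst 1%R) I.
  by apply: integral_ge0 => x _; exact: ge0.
move: hb hb' le P0.
case: (poisson sigma (cst 1%R) I) => [p||] //; last first.
  by rewrite gt0_muley ?lte_fin// => /lt_le_trans/(_ (leey _)); rewrite ltxx.
case: (poisson sigma \1_[set b] I) => [p1||] //;
  case: (poisson sigma \1_[set b'] I) => [p2||] //.
rewrite -EFinM -EFinD !lte_fin !lee_fin; lra.
Qed.

End basic_facts.

(* Main.v *)
Require Import Defs.
From mathcomp Require Import all_boot all_order all_algebra.
From mathcomp Require Import all_classical all_reals all_analysis.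
From mathcomp Require Import measurable_realfun.
From mathcomp Require Import ring lra.

Set Implicit Arguments.
Unset Strict Implicit.
Unset Printing Implicit Defensive.

Import Order.TTheory GRing.Theory Num.Theory.
Import numFieldNormedType.Exports.

Local Open Scope classical_set_scope.
Local Open Scope ring_scope.

(** Write [c] for the centre of [I], [L] for its length and
    [K x = L / (L ^+ 2 + (x - c) ^+ 2)] for the Poisson kernel, so that
    [poisson mu (cst 1) I] is the integral of [K].  On [I] one has
    [K >= 4 / (5 * L)], hence [mu I] is at most [5 / 4 * L] times the part of the
    Poisson integral over [I] ([measure_itv_le_poisson]).  Off [I] one has
    [(x - c) ^- 2 <= 5 / L * K x], hence the tail integral of [nu] is at most
    [5 / L] times the part of its Poisson integral over the complement of [I]
    ([tail_itv_le_poisson]).  The product of the two constants is [(5 / 2) ^+ 2].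

    Only one of the two measures has to be stripped of its atom, and which one is
    decided by the position of the removed point [b].  If [b] lies off [I], then
    [mu] and [mu] without its atom at [b] agree on [I]; if [b] lies in [I], then
    [nu] and [nu] without its atom at [b] agree off [I].  So the local product
    [mu I * tail nu] is bounded by one of the two summands in the supremum that
    defines [A2_double_star] ([tail_testing_le]).  Exchanging [mu]
    and [nu] exchanges the two summands, so each of the two one-tailed constants
    is at most [5 / 2 * A2_double_star sigma w], and their sum at most
    [5 * A2_double_star sigma w]. *)

Section interval_geometry.
Context {R : realType}.
Implicit Types (I : interval R) (x : R).

Lemma itv_length_gt0 I : finite_itv I -> 0 < itv_length I.
Proof. by case: I => [[bl l|//] [br r|//]] /=; rewrite subr_gt0. Qed.

Lemma sqr_dist_center_in I x : finite_itv I -> [set` I] x ->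
  4 * (x - miditv I) ^+ 2 <= itv_length I ^+ 2.
Proof.
case: I => [[bl l|//] [br r|//]] /= lr.
rewrite itv_boundlr => /andP[/lteifW /= lx /lteifW /= xr].
have -> : 4 * (x - (l + r) / 2) ^+ 2 = (r - l) ^+ 2 - 4 * ((x - l) * (r - x)).
  by field.
by rewrite gerBl !mulr_ge0// subr_ge0.
Qed.

Lemma sqr_dist_center_out I x : finite_itv I -> ~ [set` I] x ->
  itv_length I ^+ 2 <= 4 * (x - miditv I) ^+ 2.
Proof.
case: I => [[bl l|//] [br r|//]] /= lr /negP.
rewrite itv_boundlr negb_and => xI.
have -> : 4 * (x - (l + r) / 2) ^+ 2 = (r - l) ^+ 2 + 4 * ((l - x) * (r - x)).
  by field.
rewrite lerDl pmulr_rge0//; case/orP: xI => h.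
- have xl : x <= l.
    by move: h; case: bl; rewrite bnd_simp -?ltNge -?leNgt // => /ltW.
  by rewrite mulr_ge0 ?subr_ge0// (le_trans xl (ltW lr)).
- have rx : r <= x.
    by move: h; case: br; rewrite bnd_simp -?ltNge -?leNgt // => /ltW.
  by rewrite mulr_le0 ?subr_le0// (le_trans (ltW lr) rx).
Qed.

End interval_geometry.

Local Open Scope ereal_scope.

Section poisson_lower_bounds.
Context {R : realType}.
Implicit Types (mu nu : {measure set (measurableTypeR R) -> \bar R}).
Implicit Types (I : interval R) (A : set (measurableTypeR R)).

(** The factor [cst 1 x] is kept so that the integral of this kernel is
    [poisson _ (cst 1) I] by conversion. *)
Definition poisson_kernel I (x : R) : \bar R :=
  (itv_length I * cst 1%R x / (itv_length I ^+ 2 + (x - miditv I) ^+ 2))%:E.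

Lemma poisson_kernel_ge0 I (x : R) : finite_itv I -> 0 <= poisson_kernel I x.
Proof.
move=> /itv_length_gt0 L0.
by rewrite lee_fin divr_ge0 ?mulr1 ?addr_ge0 ?sqr_ge0 ?ltW.
Qed.

Lemma measurable_poisson_kernel I A : finite_itv I ->
  measurable_fun A (poisson_kernel I : measurableTypeR R -> \bar R).
Proof.
move=> fI; apply: measurable_funTS.
by apply: (measurable_poisson fI); exact: measurable_cst.
Qed.

(** A point of [I] is within [L / 2] of the centre, so the denominator of the
    kernel is at most [5 / 4 * L ^+ 2] there. *)
Lemma measure_itv_le_poisson mu I : finite_itv I ->
  mu [set` I] <=
    (5 / 4 * itv_length I)%:E * \int[mu]_(x in [set` I]) poisson_kernel I x.
Proof.
move=> fI; have L0 := itv_length_gt0 fI.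
have mI : measurable ([set` I] : set (measurableTypeR R)).
  exact: measurable_itv.
rewrite -[leLHS]mul1e -(integral_cst mu mI) -ge0_integralZl_EFin//; last 3 first.
- by move=> x _; exact: poisson_kernel_ge0.
- exact: measurable_poisson_kernel.
- by rewrite mulr_ge0// ltW.
apply: ge0_le_integral => //.
- by apply: measurable_funeM; exact: measurable_poisson_kernel.
move=> x Ix; rewrite -EFinM lee_fin mulr1 mulrA.
have d4 := sqr_dist_center_in fI Ix.
have L20 : (0 < itv_length I ^+ 2)%R by rewrite exprn_gt0.
have d0 : (0 <= (x - miditv I) ^+ 2)%R by exact: sqr_ge0.
rewrite ler_pdivlMr ?mul1r; last by rewrite ltr_wpDr.
rewrite -[leRHS]mulrA -expr2; lra.
Qed.

(** Off [I] the distance to the centre is at least [L / 2], so the denominator of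
    the kernel is at most [5 * (x - c) ^+ 2]. *)
Lemma tail_itv_le_poisson nu I : finite_itv I ->
  \int[nu]_(x in ~` [set` I]) ((x - miditv I) ^- 2)%:E <=
    (5 / itv_length I)%:E * \int[nu]_(x in ~` [set` I]) poisson_kernel I x.
Proof.
move=> fI; have L0 := itv_length_gt0 fI.
have mI : measurable (~` [set` I] : set (measurableTypeR R)).
  by apply: measurableC; exact: measurable_itv.
have L20 : (0 < itv_length I ^+ 2)%R by rewrite exprn_gt0.
have d0 x : (~` [set` I]) x -> (0 < (x - miditv I) ^+ 2)%R.
  move=> /(sqr_dist_center_out fI) /(lt_le_trans L20).
  by rewrite pmulr_rgt0.
rewrite -ge0_integralZl_EFin//; last 3 first.
- by move=> x _; exact: poisson_kernel_ge0.
- exact: measurable_poisson_kernel.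
- by rewrite divr_ge0// ltW.
apply: ge0_le_integral => //.
- by move=> x _; rewrite lee_fin invr_ge0 sqr_ge0.
- apply/measurable_EFinP; apply: subspace_continuous_measurable_fun => //.
  apply: continuous_in_subspaceT => x /set_mem /d0 x0.
  apply: cvgV; first by rewrite gt_eqF.
  by apply: cvgM; apply: cvgB; solve [exact: cvg_id|exact: cvg_cst].
- by apply: measurable_funeM; exact: measurable_poisson_kernel.
move=> x /[dup] /d0 x0 /(sqr_dist_center_out fI) d4.
rewrite -EFinM lee_fin mulr1 mulrA divfK ?gt_eqF//.
rewrite ler_pdivlMr ?addr_gt0// mulrC ler_pdivrMr//; lra.
Qed.

Import HBNNSimple.

(** Serves to replace [remove_atom mu b], a bare set function, by a measure with
    the same values on measurable sets.  The integral uses only the values on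
    level sets of simple functions, and those are measurable. *)
Lemma eq_integral_setfun (m1 m2 : set (measurableTypeR R) -> \bar R)
    (D : set (measurableTypeR R)) (f : measurableTypeR R -> \bar R) :
  (forall A, measurable A -> m1 A = m2 A) ->
  \int[m1]_(x in D) f x = \int[m2]_(x in D) f x.
Proof.
move=> m12.
have m12s (h : {nnsfun measurableTypeR R >-> R}) :
    sintegral m1 h = sintegral m2 h.
  by apply: eq_fsbigr => r _; rewrite m12.
rewrite /integral; congr (ereal_sup _ - ereal_sup _); apply: eq_imagel => h _;
  exact: m12s.
Qed.

(** [mu] with its atom at [b] removed is the restriction of [mu] to the
    complement of [b], and this changes nothing on a set that misses [b]. *)
Lemma integral_le_remove_atom mu (b : R) A (f : measurableTypeR R -> \bar R) :
  radon mu -> measurable A -> ~ A b ->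
  measurable_fun setT f -> (forall x, 0 <= f x) ->
  \int[mu]_(x in A) f x <= \int[remove_atom mu b]_x f x.
Proof.
move=> rmu mA Ab mf f0.
have mC : measurable (~` [set b] : set (measurableTypeR R)).
  by apply: measurableC; exact: measurable_set1.
rewrite (@eq_integral_setfun (remove_atom mu b) (mrestr mu mC)); last first.
  by move=> B mB; rewrite remove_atomE// /mrestr setDE.
rewrite (@eq_measure_integral _ _ _ _ (mrestr mu mC)); last first.
  move=> B mB BA; rewrite /= /mrestr setIidl// => x Bx xb.
  by apply: Ab; rewrite -xb; exact: BA.
exact: ge0_subset_integral.
Qed.

(** [tilde sigma w I mu] is [drop_atom (atom_pt sigma w I) mu] by conversion. *)
Definition drop_atom (o : option R) mu : set (measurableTypeR R) -> \bar R :=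
  if o is Some b then remove_atom mu b else mu.

Lemma poisson_ge0 mu I : finite_itv I -> 0 <= poisson mu (cst 1%R) I.
Proof. by move=> fI; apply: integral_ge0 => x _; exact: poisson_kernel_ge0. Qed.

Lemma integral_le_poisson mu I A : finite_itv I -> measurable A ->
  \int[mu]_(x in A) poisson_kernel I x <= poisson mu (cst 1%R) I.
Proof.
move=> fI mA; apply: ge0_subset_integral => //.
- exact: measurable_poisson_kernel.
- by move=> x _; exact: poisson_kernel_ge0.
Qed.

Lemma integral_le_poisson_drop mu (o : option R) I A :
  radon mu -> finite_itv I -> measurable A -> (forall b, o = Some b -> ~ A b) ->
  \int[mu]_(x in A) poisson_kernel I x <= poisson (drop_atom o mu) (cst 1%R) I.
Proof.
move=> rmu fI mA; case: o => [b /(_ b erefl) Ab|_] /=.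
  apply: integral_le_remove_atom => //; first exact: measurable_poisson_kernel.
  by move=> x; exact: poisson_kernel_ge0.
exact: integral_le_poisson.
Qed.

Lemma poisson_drop_ge0 mu (o : option R) I : radon mu -> finite_itv I ->
  0 <= poisson (drop_atom o mu) (cst 1%R) I.
Proof.
move=> rmu fI.
have := @integral_le_poisson_drop mu o I set0 rmu fI measurable0.
by rewrite integral_set0; apply=> b _ [].
Qed.

(** The mass of [mu] is taken on [I] and the tail of [nu] off [I], so a single
    point meets only one of the two sets; the measure that can be stripped is
    the one whose set the point misses. *)
Lemma tail_testing_le mu nu (o : option R) I :
  radon mu -> radon nu -> finite_itv I ->
  mu [set` I] * \int[nu]_(x in ~` [set` I]) ((x - miditv I) ^- 2)%:E <=
  ((5 / 2) ^+ 2)%:E *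
    (poisson (drop_atom o mu) (cst 1%R) I * poisson nu (cst 1%R) I
     + poisson (drop_atom o nu) (cst 1%R) I * poisson mu (cst 1%R) I).
Proof.
move=> rmu rnu fI; have L0 := itv_length_gt0 fI.
have mI : measurable ([set` I] : set (measurableTypeR R)).
  exact: measurable_itv.
have mIC := measurableC mI.
have k0 (m : {measure set (measurableTypeR R) -> \bar R}) A :
    0 <= \int[m]_(x in A) poisson_kernel I x.
  by apply: integral_ge0 => x _; exact: poisson_kernel_ge0.
have t0 : 0 <= \int[nu]_(x in ~` [set` I]) ((x - miditv I) ^- 2)%:E.
  by apply: integral_ge0 => x _; rewrite lee_fin invr_ge0 sqr_ge0.
apply: (le_trans (lee_pmul (measure_ge0 _ _) t0
  (measure_itv_le_poisson mu fI) (tail_itv_le_poisson nu fI))).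
have -> : ((5 / 2) ^+ 2 = 5 / 4 * itv_length I * (5 / itv_length I))%R.
  by field; rewrite gt_eqF.
rewrite muleACA -EFinM lee_wpmul2l//.
  by rewrite lee_fin !mulr_ge0 ?invr_ge0// ltW.
have [oI|oI] := pselect (exists2 b, o = Some b & [set` I] b).
(* The removed point lies in [I]: [nu] loses nothing off [I]. *)
- apply: (le_trans _ (leeDr _ _)); last first.
    by rewrite mule_ge0 ?poisson_drop_ge0 ?poisson_ge0.
  rewrite muleC; apply: lee_pmul => //; last exact: integral_le_poisson.
  apply: integral_le_poisson_drop => // b ob.
  by case: oI => b'; rewrite ob => -[<-] Ib nIb; exact: nIb.
(* No point of [I] is removed: [mu] loses nothing on [I]. *)
- apply: (le_trans _ (leeDl _ _)); last first.
    by rewrite mule_ge0 ?poisson_drop_ge0 ?poisson_ge0.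
  apply: lee_pmul => //; last exact: integral_le_poisson.
  by apply: integral_le_poisson_drop => // b ob Ib; apply: oI; exists b.
Qed.

End poisson_lower_bounds.

Section comparison.
Context {R : realType}.
Implicit Types (mu nu sigma w : {measure set (measurableTypeR R) -> \bar R}).

Let A2_quantity sigma w (I : interval R) : \bar R :=
  poisson (tilde sigma w I sigma) (cst 1%R) I * poisson w (cst 1%R) I
  + poisson (tilde sigma w I w) (cst 1%R) I * poisson sigma (cst 1%R) I.

Lemma A2_star_le mu nu (S : \bar R) : 0 <= S ->
  (forall I, finite_itv I ->
    mu [set` I] * \int[nu]_(x in ~` [set` I]) ((x - miditv I) ^- 2)%:E
      <= ((5 / 2) ^+ 2)%:E * S) ->
  A2_star mu nu <= (5 / 2)%:E * sqrte S.
Proof.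
move=> S0 H; apply: ereal_inf_lbound => /=; split.
  by rewrite mule_ge0 ?sqrte_ge0.
move=> I fI; apply: (le_trans (H I fI)).
by rewrite -{1}(sqr_sqrte S0) !expe2 muleACA -EFinM -expr2.
Qed.

Lemma A2_star_le_double_star sigma w : radon sigma -> radon w ->
  A2_star sigma w <= (5 / 2)%:E * A2_double_star sigma w /\
  A2_star w sigma <= (5 / 2)%:E * A2_double_star sigma w.
Proof.
move=> rs rw.
have ub I : finite_itv I -> A2_quantity sigma w I <=
    ereal_sup [set A2_quantity sigma w J | J in [set J | finite_itv J]].
  by move=> fI; apply: ereal_sup_ubound; exists I.
have S0 : 0 <= ereal_sup
    [set A2_quantity sigma w J | J in [set J | finite_itv J]].
  (* The supremum is over a non-empty family of nonnegative quantities. *)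
  have fI : finite_itv (`[0%R, 1%R] : interval R) by exact: ltr01.
  apply: le_trans (ub _ fI).
  have d0 mu : radon mu ->
      0 <= poisson (tilde sigma w `[0%R, 1%R] mu) (cst 1%R) `[0%R, 1%R].
    by move=> rmu; exact: (poisson_drop_ge0 (atom_pt sigma w _) rmu fI).
  by apply: adde_ge0; apply: mule_ge0;
    [exact: d0|exact: poisson_ge0|exact: d0|exact: poisson_ge0].
split; apply: A2_star_le => // I fI.
- apply: (le_trans (tail_testing_le (atom_pt sigma w I) rs rw fI)).
  by rewrite lee_wpmul2l// ub.
- apply: (le_trans (tail_testing_le (atom_pt sigma w I) rw rs fI)).
  by rewrite lee_wpmul2l// addeC ub.
Qed.

End comparison.

Local Close Scope ereal_scope.

Theorem lemma1p2 (R : realType) :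
  exists C : R, (0 < C)%R /\
    forall sigma w : {measure set (measurableTypeR R) -> \bar R},
      radon sigma -> radon w ->
      ((A2_double_star sigma w < +oo)%E ->
         (A2_star sigma w < +oo)%E /\ (A2_star w sigma < +oo)%E) /\
      (A2_star sigma w + A2_star w sigma <= C%:E * A2_double_star sigma w)%E.
Proof.
exists 5; split => // sigma w rs rw.
have [sw ws] := A2_star_le_double_star rs rw.
have A0 : (0 <= A2_double_star sigma w)%E by exact: sqrte_ge0.
split => [Afin|].
  have Cfin : ((5 / 2)%:E * A2_double_star sigma w < +oo)%E.
    by rewrite lte_mul_pinfty.
  by split; [exact: le_lt_trans sw Cfin|exact: le_lt_trans ws Cfin].
have -> : (5 : R) = 5 / 2 + 5 / 2 by field.
by rewrite EFinD ge0_muleDl// leeD.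
Qed.
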